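(* Let $n$ be an odd positive integer, $G=\mathbb{Z}/n\mathbb{Z}$, and $S\subset G^n$ the set of bijections $\{1,\dots,n\}\to G$. Let $r_1,\dots,r_k\in\frac1n\mathbb{Z}/\mathbb{Z}$ be distinct and $a_1,\dots,a_k$ positive integers with $\sum_{i=1}^k a_i=n$, and let $\chi$ be any $n$-tuple in $(\frac1n\mathbb{Z}/\mathbb{Z})^n$ in which each $r_i$ appears exactly $a_i$ times. Then \[ |\widehat{1_S}(\chi)|\le\binom{n+k-1}{k-1}^{1/2}\binom{n}{a_1,\dots,a_k}^{-1/2}\frac{n!}{n^n}. \]
   Context: Characters of $G^n$ are identified with $n$-tuples $\chi=(r_1,\dots,r_n)\in(\frac1n\mathbb{Z}/\mathbb{Z})^n$, and \[ \widehat{1_S}(r_1,\dots,r_n)=\frac1{n^n}\sum_{\substack{x_1,\dots,x_n\in G\\ \text{distinct}}} e(-r_1x_1-\cdots-r_nx_n),\qquad e(x)=e^{2\pi i x}. \] *)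

(* Defs.v *)
From HB Require Import structures.
From mathcomp Require Import all_boot all_order all_algebra.
From mathcomp Require Import complex.
From mathcomp Require Import all_classical all_reals all_analysis.

Set Implicit Arguments.
Unset Strict Implicit.
Unset Printing Implicit Defensive.

Import Order.TTheory GRing.Theory Num.Theory.

Local Open Scope ring_scope.
Local Open Scope complex_scope.

(* Z/nZ for n > 0, with its canonical additive group structure.  Not 'Z_n,
   which is the ring of integers modulo max(n, 2) and so is wrong for n = 1. *)
Notation Zmod n := 'I_n.-1.+1 (only parsing).

(* (1/n)Z/Z for n > 0: the index j stands for the class of j/n modulo 1. *)
Notation ratmod n := 'I_n.-1.+1 (only parsing).

Definition ratmod_repr (R : realType) (n : nat) (r : ratmod n) : R :=
  r%:R / n%:R.

(* exp(2 i pi x), through Euler's formula *)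
Definition e (R : realType) (x : R) : R[i] :=
  cos (2 * pi * x) +i* sin (2 * pi * x).

(* r_1 x_1 + ... + r_n x_n, computed on representatives; it is well defined
   modulo 1, and is only used as an argument of the 1-periodic function e. *)
Definition pairing (R : realType) (n : nat)
    (chi : {ffun 'I_n -> ratmod n}) (x : {ffun 'I_n -> Zmod n}) : R :=
  \sum_(j < n) ratmod_repr R (chi j) * (x j)%:R.

Definition fourier (R : realType) (n : nat)
    (f : {ffun 'I_n -> Zmod n} -> R[i]) (chi : {ffun 'I_n -> ratmod n}) :
    R[i] :=
  (n ^ n)%N%:R^-1 * \sum_(x : {ffun 'I_n -> Zmod n}) f x * e (- pairing R chi x).

Definition bijections (n : nat) : {set {ffun 'I_n -> Zmod n}} :=
  [set x : {ffun 'I_n -> Zmod n} | `[< bijective x >]].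

Definition indicator (R : realType) (T : finType) (A : {set T}) (x : T) :
    R[i] := (x \in A)%:R.

(* The division is exact when \sum_i a i = n: see multinomialE. *)
Definition multinomial (n k : nat) (a : 'I_k -> nat) : nat :=
  n`! %/ \prod_(i < k) (a i)`!.

Lemma multinomialE (n k : nat) (a : 'I_k -> nat) :
  (\sum_(i < k) a i = n)%N ->
  (multinomial n a * \prod_(i < k) (a i)`! = n`!)%N.
Proof.
move=> <-; apply: divnK.
elim/big_rec2: _ => [//|i p m _ IH].
apply: (@dvdn_trans ((a i)`! * p`!)); first exact: dvdn_mul (dvdnn _) IH.
have := @bin_fact (a i + p) (a i) (leq_addr _ _).
by rewrite addKn => <-; apply: dvdn_mull.
Qed.

Lemma fourier_bijectionsE (R : realType) (n : nat)
    (chi : {ffun 'I_n -> ratmod n}) : (0 < n)%N ->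
  fourier (@indicator R _ (bijections n)) chi =
  (n ^ n)%N%:R^-1 *
    \sum_(x : {ffun 'I_n -> Zmod n} | injectiveb x)
      e (- \sum_(j < n) ratmod_repr R (chi j) * (x j)%:R).
Proof.
move=> n0; rewrite /fourier [in RHS]big_mkcond; congr (_ * _).
apply: eq_bigr => x _; rewrite /indicator inE.
have -> : `[< bijective x >] = injectiveb x.
  apply/asboolP/injectiveP => [/bij_inj //|xI].
  by apply: inj_card_bij => //; rewrite !card_ord prednK.
by case: ifP; rewrite ?mul1r ?mul0r.
Qed.

(* Main.v *)
(* Up to the factor [prod a_i!], the sum over bijections is the coefficient
   [c] of [z^a] in [F z = prod_x sum_i z_i e(- r_i x)].  By AM-GM over [x] and
   Parseval, [|F z|^2 <= (sum_i |z_i|^2)^n]; averaging over the phases of [z]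
   with [|z_i|^2 = a_i] gives [|c|^2 prod a_i^a_i <= n^n].  Conversely,
   expanding [n^n = (sum_i a_i)^n] by types, the type [a] contributes the most,
   so [n^n] is at most the number of types times the term of type [a]. *)
Require Import Defs.
From mathcomp Require Import all_boot all_order all_algebra all_fingroup.
From mathcomp Require Import complex.
From mathcomp Require Import all_classical all_reals all_analysis.
From mathcomp Require Import ring lra.

Set Implicit Arguments.
Unset Strict Implicit.
Unset Printing Implicit Defensive.

Import Order.TTheory GRing.Theory Num.Theory.

Local Open Scope ring_scope.
Local Open Scope complex_scope.

(** * Fibers of words and permutations that act on them *)

Definition fiber (T K : finType) (f : T -> K) (i : K) : {set T} :=
  [set x | f x == i].

Lemma prod_fiber (A : comPzSemiRingType) (T K : finType) (f : T -> K)
    (g : K -> A) :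
  \prod_x g (f x) = \prod_i g i ^+ #|fiber f i|.
Proof.
rewrite (partition_big f xpredT) //=; apply: eq_bigr => i _.
under eq_bigr => x /eqP-> do [].
by rewrite prodr_const; congr (_ ^+ _); apply: eq_card => x; rewrite !inE.
Qed.

Lemma sum_card_fiber (T K : finType) (f : T -> K) :
  (\sum_i #|fiber f i| = #|T|)%N.
Proof.
rewrite -sum1_card (partition_big f xpredT) //=; apply: eq_bigr => i _.
by rewrite -sum1_card; apply: eq_bigl => x; rewrite inE.
Qed.

(** A permutation preserving [f] amounts to an independent choice of a permutation of each fiber.
    Restriction to the fibers and gluing are injections in opposite directions, one for each
    inequality. *)
Lemma card_perm_fix (T K : finType) (f : T -> K) :
  #|[set s : {perm T} | [forall x, f (s x) == f x]]| =
  (\prod_i #|fiber f i| `!)%N.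
Proof.
set S := [set s | _].
have SP (s : {perm T}) : reflect (forall x, f (s x) = f x) (s \in S).
  by rewrite inE; apply: 'forall_eqP.
pose F := family (fun i : K => perm_on (fiber f i)).
have -> : (\prod_i #|fiber f i| `! = #|F|)%N.
  rewrite card_family foldrE big_map enumT.
  by apply: eq_bigr => i _; rewrite card_perm.
have restrE s i x : s \in S -> f x = i -> restr_perm (fiber f i) s x = s x.
  move=> /SP sS fx; apply: restr_permE; last by rewrite inE fx.
  by apply/astabsP => y; rewrite inE /= apermE sS [RHS]inE.
apply/eqP; rewrite eqn_leq; apply/andP; split.
  pose h (s : {perm T}) := [ffun i => restr_perm (fiber f i) s].
  rewrite -(@card_in_imset _ _ h) => [|s t sS tS /ffunP st].
    apply/subset_leq_card/fintype.subsetP => _ /imsetP[s _ ->].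
    by apply/familyP => i; rewrite ffunE; apply: restr_perm_on.
  apply/permP => x; have := st (f x); rewrite !ffunE => /permP/(_ x).
  by rewrite !restrE.
pose glue (p : {ffun K -> {perm T}}) x := p (f x) x.
have fglue p x : p \in F -> f (glue p x) = f x.
  move=> /familyP/(_ (f x)) pF; have := perm_closed x pF.
  by rewrite !inE eqxx => /eqP.
have glue_inj p : p \in F -> injective (glue p).
  move=> pF x y exy; have fxy : f x = f y by rewrite -(fglue p x) // exy fglue.
  by move: exy; rewrite /glue fxy; apply: perm_inj.
(* For [p] in [F] the glued map is injective, hence a permutation, so the default [1] is never taken
   there. *)
pose h p := odflt 1%g [pick s : {perm T} | [forall x, s x == glue p x]].
have hE p x : p \in F -> h p x = glue p x.
  move=> pF; rewrite /h; case: pickP => [s /'forall_eqP -> //|].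
  move=> /(_ (perm (glue_inj p pF)))/negP[]; apply/'forall_eqP => y.
  by rewrite permE.
rewrite -(@card_in_imset _ _ h) => [|p q pF qF hpq].
  apply/subset_leq_card/fintype.subsetP => _ /imsetP[p pF ->].
  by apply/SP => x; rewrite hE // fglue.
(* On the fiber over [i] the components are read off from the glued permutation; off it both are the
   identity. *)
apply/ffunP => i; apply/permP => x.
have [<-|fx] := eqVneq (f x) i.
  by rewrite -[LHS](hE p x) // hpq hE.
have out (q' : {ffun K -> {perm T}}) : q' \in F -> q' i x = x.
  by move=> /familyP/(_ i) qF'; rewrite (out_perm qF') // inE.
by rewrite !out.
Qed.

(** Equal fiber sizes make [g] a rearrangement [f \o s] of [f], so the permutations counted form the
    translate by [s] of those preserving [f]. *)
Lemma card_perm_comp (n : nat) (K : finType) (f g : 'I_n -> K) :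
    (forall i, #|fiber f i| = #|fiber g i|) ->
  #|[set s : {perm 'I_n} | [forall x, f (s x) == g x]]| =
  (\prod_i #|fiber f i| `!)%N.
Proof.
move=> fg.
have /tuple_permP[s sE] : perm_eq [tuple g i | i < n] [tuple f i | i < n].
  have countE (h : 'I_n -> K) i :
      count (pred1 i) (map h (enum 'I_n)) = #|fiber h i|.
    rewrite count_map cardE -size_filter; congr size.
    rewrite [RHS]/enum_mem -enumT.
    by apply: eq_filter => x; rewrite !inE.
  by apply/allP => i _; rewrite /= !countE fg.
have {}sE x : g x = f (s x).
  have := congr1 (fun t => nth (g x) t x) sE.
  rewrite /= (nth_map x) ?size_enum_ord // (nth_map x) ?size_enum_ord //.
  by rewrite nth_ord_enum /tnth (nth_map x) ?size_enum_ord ?ltn_ord //= nth_ord_enum.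
rewrite -card_perm_fix -[RHS](card_imset _ (@mulgI _ s)).
apply: eq_card => t; rewrite inE; apply/'forall_eqP/imsetP.
  move=> tE; exists (s^-1 * t)%g; last by rewrite mulKVg.
  by rewrite inE; apply/'forall_eqP => x; rewrite permM tE sE permKV.
by move=> [u]; rewrite inE => /'forall_eqP uE -> x; rewrite permM uE sE.
Qed.

(** * Counting words by type *)

(** The factors of [q!/p!] beyond [p] are at least [p], and those of [p!/q!] are at most [p].
    Applied letter by letter, this makes the type [a] the heaviest one. *)
Lemma expn_fact_le (p q : nat) : (p ^ q * p`! <= p ^ p * q`!)%N.
Proof.
have [pq|qp] := leqP p q.
  rewrite -(subnKC pq); elim: (q - p)%N => [|d IH]; first by rewrite addn0.
  rewrite addnS expnS factS -mulnA [leqRHS]mulnCA.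
  by rewrite leq_mul // leqW // leq_addr.
(* The base [m] is kept apart from [q + d] so that the induction on [d] leaves it fixed. *)
suff le_fact m d : (q + d <= m -> m ^ q * (q + d)`! <= m ^ (q + d) * q`!)%N.
  by have := le_fact p (p - q)%N; rewrite subnKC ?(ltnW qp) // leqnn; exact.
elim: d => [|d IH]; rewrite ?addn0 // addnS => dm.
by rewrite expnS factS mulnCA -mulnA leq_mul // IH // ltnW.
Qed.

Lemma card_types (n k : nat) :
  #|[set b : {ffun 'I_k.+1 -> 'I_n.+1} | (\sum_i b i)%N == n]| = 'C(n + k, k).
Proof.
rewrite addnC -card_ord_partitions.
pose h (b : {ffun 'I_k.+1 -> 'I_n.+1}) := [tuple b i | i < k.+1].
rewrite -(@card_imset _ _ h) => [|b c bc].
  apply: eq_card => t; rewrite inE; apply/imsetP/idP.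
    by move=> [b]; rewrite inE => bn ->; rewrite big_map big_enum.
  move=> tn; exists [ffun i => tnth t i]; last first.
    by apply: eq_from_tnth => i; rewrite tnth_mktuple ffunE.
  by rewrite inE; under eq_bigr do rewrite ffunE; rewrite -(big_tuple _ _ t xpredT).
by apply/ffunP => i; move/(congr1 (fun t => tnth t i)): bc; rewrite !tnth_mktuple.
Qed.

(** Permuting the positions of one word [f0] of type [b] reaches every word of that type, each from
    [\prod_i (b i)!] permutations. Only an inequality is claimed, as no word has type [b] when the
    [b i] do not sum to [n]. *)
Lemma card_type_le (n : nat) (K : finType) (b : K -> nat) :
  (#|[set f : {ffun 'I_n -> K} | [forall i, #|fiber f i| == b i]]| *
     \prod_i (b i)`! <= n`!)%N.
Proof.
set B := [set f | _].
have [-> | [f0 f0B]] := set_0Vmem B; first by rewrite cards0.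
have BP f : f \in B -> forall i, #|fiber f i| = b i.
  by rewrite inE => /'forall_eqP.
rewrite -sum_nat_const.
have -> : n`! = #|{perm 'I_n}|.
  rewrite -[n in LHS]card_ord -cardsT -card_perm.
  by apply: eq_card => s; rewrite !inE; apply/fintype.subsetP => x _; rewrite inE.
rewrite -sum1_card.
rewrite (partition_big (fun s : {perm 'I_n} => [ffun x => f0 (s x)]) xpredT) //=.
rewrite [leqRHS](bigID (mem B)) /=; apply: leq_trans (leq_addr _ _).
apply: leq_sum => f fB.
rewrite -(eq_bigr _ (fun i _ => congr1 factorial (BP _ f0B i))).
rewrite -(@card_perm_comp _ _ f0 f) => [|i]; last by rewrite !BP.
rewrite sum1dep_card; apply/subset_leq_card/fintype.subsetP => s; rewrite !inE.
by move=> /'forall_eqP sf; apply/eqP/ffunP => x; rewrite ffunE.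
Qed.

(* Among the types of words of length [n], the type [a] itself has the largest
   mass for the weights [a], and there are ['C(n + k, k)] types. *)
Lemma expn_le_type (n k : nat) (a : 'I_k.+1 -> nat) :
  (\sum_i a i = n)%N ->
  (n ^ n * \prod_i (a i)`! <= 'C(n + k, k) * (n`! * \prod_i a i ^ a i))%N.
Proof.
move=> an.
have -> : (n ^ n = \sum_(f : {ffun 'I_n -> 'I_k.+1}) \prod_i a i ^ #|fiber f i|)%N.
  transitivity (\prod_(x < n) \sum_i a i)%N;
    first by rewrite an prod_nat_const card_ord.
  by rewrite bigA_distr_bigA; apply: eq_bigr => f _; rewrite (prod_fiber f a).
rewrite big_distrl /= -card_types -sum_nat_const.
pose t (f : {ffun 'I_n -> 'I_k.+1}) : {ffun 'I_k.+1 -> 'I_n.+1} :=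
  [ffun i => inord #|fiber f i|].
have tE f i : t f i = #|fiber f i| :> nat.
  by rewrite ffunE inordK // ltnS -[leqRHS]card_ord max_card.
rewrite (partition_big t
  [in [set b : {ffun 'I_k.+1 -> 'I_n.+1} | (\sum_i b i)%N == n]]) /=; last first.
  move=> f _; rewrite inE; under eq_bigr do rewrite tE.
  by rewrite sum_card_fiber card_ord.
apply: leq_sum => b _.
rewrite (eq_bigl [in [set f | t f == b]]) => [|f]; last by rewrite inE.
(* Each word of type [b] is bounded through [expn_fact_le]; the factor [\prod_i (b i)!] this
   produces is what [card_type_le] absorbs into [n!]. *)
apply: (@leq_trans (\sum_(f in [set f | t f == b])
  ((\prod_i (b i)`!) * \prod_i a i ^ a i)%N)).
  apply: leq_sum => f; rewrite inE => /eqP <-.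
  rewrite -!big_split /=; apply: leq_prod => i _.
  by rewrite tE [leqRHS]mulnC expn_fact_le.
rewrite sum_nat_const mulnA leq_mul2r.
rewrite (leq_trans _ (card_type_le n (fun i => b i))) ?orbT //.
rewrite leq_mul2r subset_leq_card ?orbT //; apply/fintype.subsetP => f.
by rewrite !inE => /eqP <-; apply/forallP => i; rewrite tE.
Qed.

(** * The exponential [e] and orthogonality of characters *)

Lemma eD (R : realType) (x y : R) : e (x + y) = e x * e y.
Proof.
rewrite /e mulrDr cosD sinD; apply/eqP; rewrite eq_complex /=.
by rewrite eqxx /= [X in _ == X]addrC eqxx.
Qed.

Lemma e0 (R : realType) : e (0 : R) = 1.
Proof. by rewrite /e mulr0 cos0 sin0. Qed.

Lemma e_natmul (R : realType) (x : R) (n : nat) : e (n%:R * x) = e x ^+ n.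
Proof.
elim: n => [|n IH]; first by rewrite mul0r e0.
by rewrite -natr1 mulrDl mul1r eD IH exprSr.
Qed.

Lemma e_sum (R : realType) (I : finType) (F : I -> R) :
  e (\sum_i F i) = \prod_i e (F i).
Proof. by apply: (big_morph _ (@eD R) (e0 R)). Qed.

Lemma norm_e (R : realType) (x : R) : `|e x| = 1.
Proof. by rewrite normc_def /= cos2Dsin2 sqrtr1. Qed.

Lemma eN (R : realType) (x : R) : e (- x) = (e x)^-1.
Proof.
have ex0 : e x != 0 by rewrite -normr_eq0 norm_e oner_eq0.
by apply: (mulfI ex0); rewrite -eD subrr e0 divff.
Qed.

Lemma conj_e (R : realType) (x : R) : (Num.conj (e x)) = e (- x).
Proof. by rewrite eN invC_norm norm_e expr1n invr1 mul1r. Qed.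

Lemma e_nat (R : realType) (n : nat) : e (n%:R : R) = 1.
Proof.
rewrite -[n%:R]mulr1 e_natmul.
by rewrite /e mulr1 -mulrC mulr_natr cos2pi sin2pi expr1n.
Qed.

Lemma e_neq1 (R : realType) (x : R) : 0 < x < 1 -> e x != 1.
Proof.
move=> /andP[x0 x1].
have s0 : 0 < sin (pi * x).
  by apply: sin_gt0_pi; rewrite mulr_gt0 ?pi_gt0 //= gtr_pMr ?pi_gt0.
apply/negP; rewrite eq_complex /= => /andP[+ _].
(* By the double angle formula, [cos (2 pi x) = 1] would force [cos (pi x) ^+ 2 = 1], against
   [sin (pi x) > 0]. *)
rewrite -mulrA mulr_natl cos_mulr2n => /eqP c1.
have /eqP := cos2Dsin2 (pi * x); have := exprn_gt0 2 s0; rewrite -mulr_natl in c1.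
lra.
Qed.

Lemma e_orthogonality (R : realType) (N p q : nat) : (p < N)%N -> (q < N)%N ->
  \sum_(m < N) e (m%:R * ((p%:R - q%:R) / N%:R) : R) = (N * (p == q))%:R.
Proof.
move=> pN qN.
have N0 : (N%:R : R) != 0 by rewrite pnatr_eq0; case: N pN {qN}.
have Ngt0 : (0 : R) < N%:R by rewrite lt0r N0 ler0n.
have [<-|pq] := eqVneq p q.
  under eq_bigr do rewrite subrr mul0r mulr0 e0.
  by rewrite sumr_const card_ord muln1.
rewrite muln0; under eq_bigr do rewrite e_natmul.
set z := e _.
have zN : z ^+ N = 1.
  by rewrite -e_natmul mulrC divfK // eD eN !e_nat invr1 mulr1.
have z1 : z != 1.
  (* [e_neq1] needs an argument in the open unit interval, so the larger index comes first; the
     other order follows by inversion. *)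
  have frac_neq1 (s t : nat) : (t < s)%N -> (s < N)%N ->
      e ((s%:R - t%:R) / N%:R : R) != 1.
    move=> ts sN; apply: e_neq1; rewrite divr_gt0 ?subr_gt0 ?ltr_nat //=.
    rewrite ltr_pdivrMr // mul1r ltrBlDr.
    by rewrite (lt_le_trans (y := N%:R)) ?ltr_nat // lerDl ler0n.
  have [qp|] := ltnP q p; first exact: frac_neq1.
  rewrite leq_eqVlt (negPf pq) /= => /frac_neq1 /(_ qN).
  by rewrite -opprB mulNr eN invr_eq1.
apply/eqP; have /eqP := subrX1 z N; rewrite zN subrr eq_sym.
by rewrite mulf_eq0 subr_eq0 (negPf z1).
Qed.

(** * Parseval and the bound on a coefficient *)

(** Expanding the square and summing over [x] first, orthogonality kills the cross terms, the
    frequencies [r i] being distinct and below [n]. *)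
Lemma parseval (R : realType) (n k : nat) (r : 'I_k -> nat) (z : 'I_k -> R[i]) :
    injective r -> (forall i, r i < n)%N ->
  \sum_(x < n) `|\sum_i z i * e (- ((r i)%:R / n%:R * x%:R))| ^+ 2 =
  n%:R * \sum_i `|z i| ^+ 2.
Proof.
move=> r_inj r_lt.
under eq_bigr => x _.
  rewrite normCK rmorph_sum mulr_suml.
  under eq_bigr => i _ do rewrite mulr_sumr.
  over.
rewrite exchange_big mulr_sumr; apply: eq_bigr => i _ /=.
rewrite exchange_big /=.
transitivity (\sum_j z i * Num.conj (z j) * (n * (r j == r i))%:R).
  apply: eq_bigr => j _; rewrite -(e_orthogonality R) // mulr_sumr.
  apply: eq_bigr => x _; rewrite rmorphM /= conj_e mulrACA -eD.
  congr (_ * e _); lra.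
rewrite (bigD1 i) //= eqxx muln1 big1 => [|j ji].
  by rewrite addr0 normCK mulrC.
by rewrite (inj_eq r_inj) (negPf ji) muln0 mulr0.
Qed.

Lemma norm_prod_le (R : realType) (n k : nat) (r : 'I_k -> nat) (z : 'I_k -> R[i]) :
    injective r -> (forall i, r i < n)%N ->
  `|\prod_(x < n) \sum_i z i * e (- ((r i)%:R / n%:R * x%:R))| ^+ 2 <=
  (\sum_i `|z i| ^+ 2) ^+ n.
Proof.
move=> r_inj r_lt.
(* The empty product is treated apart, since the arithmetic mean divides by [n]. *)
case: n r_lt => [|n] r_lt; first by rewrite big_ord0 normr1 expr1n.
rewrite normr_prod -prodrXl.
have [le_agm _] := leif_AGM (A := [pred x : 'I_n.+1 | true])
  (E := fun x => `|\sum_i z i * e (- ((r i)%:R / n.+1%:R * x%:R))| ^+ 2)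
  (fun x _ => exprn_ge0 2 (normr_ge0 _)).
apply: le_trans le_agm _.
by rewrite parseval // card_ord mulrC mulKf ?pnatr_eq0.
Qed.

(* [prod_x sum_i z_i e(- r_i x / n)] is averaged against characters of
   [z_i = sqrt (a_i) e(m_i / (n + 1))] in [m]: since fibers have at most [n]
   elements, this isolates the coefficient of [z^a]. *)
Lemma norm_type_sum_le (R : realType) (n k : nat) (r a : 'I_k -> nat) :
    injective r -> (forall i, r i < n)%N -> (\sum_i a i = n)%N ->
  `|\sum_(f : {ffun 'I_n -> 'I_k} | [forall i, #|fiber f i| == a i])
      \prod_(x < n) e (- ((r (f x))%:R / n%:R * x%:R) : R)| ^+ 2
    * (\prod_i a i ^ a i)%N%:R <= (n ^ n)%N%:R.
Proof.
move=> r_inj r_lt a_sum.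
set c := \sum_(f | _) _; pose N := n.+1.
have leN b : (b <= n)%N -> (b < N)%N by [].
have a_le i : (a i <= n)%N by rewrite -a_sum (bigD1 i) //= leq_addr.
have fiber_le (f : {ffun 'I_n -> 'I_k}) i : (#|fiber f i| <= n)%N.
  by rewrite -[leqRHS]card_ord max_card.
pose s i : R[i] := sqrtC (a i)%:R.
have s_ge0 i : 0 <= s i by rewrite sqrtC_ge0 ler0n.
pose z (m : {ffun 'I_k -> 'I_N}) i : R[i] := s i * e ((m i)%:R * (1 / N%:R)).
pose F m := \prod_(x < n) \sum_i z m i * e (- ((r i)%:R / n%:R * x%:R)).
have F_le m : `|F m| ^+ 2 <= (n ^ n)%N%:R.
  apply: le_trans (norm_prod_le _ r_inj r_lt) _; rewrite natrX.
  under eq_bigr => i _.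
    rewrite normrM norm_e mulr1 ger0_norm // sqrtCK; over.
  by rewrite -natr_sum a_sum.
pose A := \prod_i s i ^+ a i.
have A_ge0 : 0 <= A by apply: prodr_ge0 => i _; apply: exprn_ge0.
have AE : A ^+ 2 = (\prod_i a i ^ a i)%N%:R.
  rewrite natr_prod -prodrXl; apply: eq_bigr => i _.
  by rewrite -exprM mulnC exprM sqrtCK natrX.
have avg : \sum_(m : {ffun 'I_k -> 'I_N})
      (\prod_i e (- ((m i)%:R * ((a i)%:R / N%:R)))) * F m =
    (N ^ k)%N%:R * A * c.
  under eq_bigr => m _ do rewrite /F bigA_distr_bigA mulr_sumr.
  rewrite exchange_big /=.
  rewrite [in RHS]/c [in RHS]big_mkcond mulr_sumr; apply: eq_bigr => f _.
  set W := \prod_(x < n) e _.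
  (* The sum over [m] splits into one sum per letter [i], where orthogonality tests whether the
     fiber over [i] has [a i] elements. *)
  transitivity (\prod_i (s i ^+ #|fiber f i| * (N * (#|fiber f i| == a i))%:R) * W).
    under [X in X * W]eq_bigr => i _.
      rewrite -(e_orthogonality R (leN _ (fiber_le f i)) (leN _ (a_le i))).
      rewrite mulr_sumr; over.
    rewrite bigA_distr_bigA /= mulr_suml; apply: eq_bigr => m _.
    rewrite big_split /= (prod_fiber f (z m)) mulrA -big_split /=.
    congr (_ * _); apply: eq_bigr => i _.
    rewrite exprMn -e_natmul mulrCA -eD; congr (_ * e _).
    by ring.
  case: ifPn => [/'forall_eqP fa|/forallPn[i fi]].
    rewrite big_split /= -/A; under eq_bigr do rewrite fa.
    rewrite -/A; under eq_bigr do rewrite fa eqxx muln1.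
    by rewrite prodr_const card_ord natrX [A * _]mulrC.
  by rewrite (bigD1 i) //= (negPf fi) muln0 mulr0 !mul0r mulr0.
have Nk : 0 < (N ^ k)%N%:R :> R[i] by rewrite ltr0n expn_gt0.
(* The left side of [avg] has [N ^ k] terms, each of norm at most the square root of [n ^ n], so the
   factor [N ^ k] cancels. *)
have cA_le : `|c| * A <= sqrtC (n ^ n)%N%:R.
  rewrite -(ler_pM2l Nk).
  have -> : (N ^ k)%N%:R * (`|c| * A) = `|(N ^ k)%N%:R * A * c|.
    by rewrite !normrM (ger0_norm A_ge0) (ger0_norm (ltW Nk)) -mulrA [A * _]mulrC.
  rewrite -avg.
  apply: le_trans (ler_norm_sum _ _ _) _.
  apply: (@le_trans _ _ (\sum_(m : {ffun 'I_k -> 'I_N}) sqrtC (n ^ n)%N%:R)).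
    apply: ler_sum => m _; rewrite normrM normr_prod big1 ?mul1r => [|i _].
      rewrite -(@ler_pXn2r _ 2) ?nnegrE ?sqrtC_ge0 ?normr_ge0 ?ler0n //.
      by rewrite sqrtCK.
    exact: norm_e.
  by rewrite sumr_const card_ffun !card_ord -[leLHS]mulr_natl.
rewrite -AE -exprMn -[leRHS]sqrtCK.
by rewrite (@ler_pXn2r _ 2) ?nnegrE ?sqrtC_ge0 ?ler0n // mulr_ge0.
Qed.

(** * From bijections to words, and the final bound *)

(** Precomposing [g] with permutations yields exactly the words with its fiber sizes, with the
    multiplicity given by [card_perm_comp]. *)
Lemma sum_perm_comp (A : nmodType) (n : nat) (K : finType) (g : 'I_n -> K)
    (F : {ffun 'I_n -> K} -> A) :
  \sum_(s : {perm 'I_n}) F [ffun x => g (s x)] =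
  (\sum_(f : {ffun 'I_n -> K} | [forall i, #|fiber f i| == #|fiber g i|]) F f)
    *+ (\prod_i #|fiber g i| `!)%N.
Proof.
rewrite (partition_big (fun s : {perm 'I_n} => [ffun x => g (s x)])
  [pred f : {ffun 'I_n -> K} | [forall i, #|fiber f i| == #|fiber g i|]]) /=.
  rewrite -sumrMnl; apply: eq_bigr => f /'forall_eqP fg.
  under eq_bigr => s /eqP-> do [].
  rewrite (eq_bigl [in [set s : {perm 'I_n} | [ffun x => g (s x)] == f]])
    => [|s]; last by rewrite inE.
  rewrite sumr_const -(@card_perm_comp _ _ g f) => [|i]; last by rewrite fg.
  congr (_ *+ _); apply: eq_card => s; rewrite !inE.
  apply/eqP/'forall_eqP => [/ffunP sf x|sf]; first by rewrite -sf ffunE.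
  by apply/ffunP => x; rewrite ffunE.
move=> s _; apply/'forall_eqP => i; rewrite -(card_imset _ (@perm_inj _ s)).
apply: eq_card => x; rewrite inE; apply/imsetP/eqP => [[y]|gx].
  by rewrite inE ffunE => /eqP <- ->.
by exists (s^-1%g x); rewrite ?permKV // inE ffunE permKV gx.
Qed.

Lemma sum_injective_perm (A : nmodType) (T : finType) (F : {ffun T -> T} -> A) :
  \sum_(x : {ffun T -> T} | injectiveb x) F x =
  \sum_(s : {perm T}) F [ffun i => s i].
Proof.
have valE (s : {perm T}) : [ffun i => s i] = val s.
  by apply/ffunP => i; rewrite ffunE -pvalE.
rewrite (reindex_onto val (insubd (1%g : {perm T}))) /= => [|x xI]; last first.
  by rewrite insubdK.
by apply: eq_big => [s|s _]; rewrite ?valE // valKd eqxx andbT; apply: (valP s).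
Qed.

(** The fibers over the distinct values [r i] already exhaust [T], so every other fiber is empty. *)
Lemma fibers_cover (T K Y : finType) (c : T -> Y) (r : K -> Y) :
    injective r -> (\sum_i #|fiber c (r i)| = #|T|)%N ->
  exists g : T -> K, forall x, c x = r (g x).
Proof.
move=> r_inj cT.
suff /choice[g gE] : forall x, exists i, c x = r i by exists g.
move=> x.
have [/imsetP[i _ ->]|cx] := boolP (c x \in r @: [set: K]); first by exists i.
suff : #|fiber c (c x)| == 0%N.
  by rewrite cards_eq0 => /eqP/finset.setP/(_ x); rewrite !inE eqxx.
have := sum_card_fiber c; rewrite (bigID [in r @: [set: K]]) /= big_imset /=; last first.
  by move=> i j _ _; apply: r_inj.
rewrite (eq_bigl xpredT) => [|i]; last by rewrite inE.
rewrite cT => /eqP; rewrite -[eqbRHS]addn0 eqn_add2l sum_nat_eq0.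
by move=> /forallP/(_ (c x)); rewrite cx.
Qed.

Theorem theorem4p1 (R : realType) (n : nat) (n_odd : odd n) (k : nat)
    (r : 'I_k -> ratmod n) (r_inj : injective r)
    (a : 'I_k -> nat) (a_gt0 : forall i, (0 < a i)%N)
    (a_sum : (\sum_(i < k) a i = n)%N)
    (chi : {ffun 'I_n -> ratmod n})
    (chi_r : forall i : 'I_k, #|[set j : 'I_n | chi j == r i]| = a i) :
  `|fourier (@indicator R _ (bijections n)) chi| <=
  (Num.sqrt ('C(n + k - 1, k - 1))%N%:R * (Num.sqrt (multinomial n a)%:R)^-1 *
   (n`!%:R / (n ^ n)%N%:R) : R)%:C.
Proof.
case: n n_odd r r_inj a_sum chi chi_r => // n' _.
set n := n'.+1 => r r_inj a_sum chi chi_r.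
case: k r r_inj a a_gt0 a_sum chi_r => [|k'].
  by move=> r _ a _; rewrite big_ord0.
set k := k'.+1 => r r_inj a _ a_sum chi_r.
rewrite fourier_bijectionsE // (@sum_injective_perm _ 'I_n).
have [g gE] : exists g : 'I_n -> 'I_k, forall j, chi j = r (g j).
  apply: fibers_cover => //; rewrite card_ord -[RHS]a_sum.
  by apply: eq_bigr => i _; rewrite -chi_r.
have fiber_g i : #|fiber g i| = a i.
  by rewrite -chi_r; apply: eq_card => j; rewrite !inE gE (inj_eq r_inj).
pose W (f : {ffun 'I_n -> 'I_k}) : R[i] :=
  \prod_(x < n) e (- ((r (f x))%:R / n%:R * x%:R)).
set T := \sum_(s : {perm 'I_n}) _.
have TE : T = (\sum_(f : {ffun 'I_n -> 'I_k} | [forall i, #|fiber f i| == a i]) W f)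
    *+ (\prod_i (a i)`!)%N.
  rewrite -(eq_bigr _ (fun i _ => congr1 factorial (fiber_g i))).
  rewrite (eq_bigl (fun f : {ffun 'I_n -> 'I_k} =>
    [forall i, #|fiber f i| == #|fiber g i|])) => [|f]; last first.
    by apply: eq_forallb => i; rewrite fiber_g.
  (* In [T] a permutation sends the index of [chi] to a group element, while a word in [W] sends a
     group element to a letter; inverting [s] matches the two. *)
  rewrite -sum_perm_comp (reindex_inj invg_inj); apply: eq_bigr => s _ /=.
  rewrite -sumrN e_sum [RHS](reindex_inj (@perm_inj _ s)); apply: eq_bigr => x _.
  by rewrite !ffunE permK gE.
have c_le := @norm_type_sum_le R n k (fun i => r i) a (inj_comp val_inj r_inj)
  (fun i => ltn_ord (r i)) a_sum.
have type_le := expn_le_type a_sum.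
have MP := multinomialE a_sum.
rewrite {}TE; move: c_le type_le MP; rewrite -/(W _).
set c := \sum_(f | _) _; set A := (\prod_i _ ^ _)%N; set P := (\prod_i _`!)%N.
set M := multinomial n a; rewrite {1 2}/k addnS !subn1 /=.
set B := 'C(n + k', k'); set Y := (n ^ n)%N => c_le type_le MP.
have Y_gt0 : (0 < Y)%N by rewrite expn_gt0.
have P_gt0 : (0 < P)%N by apply: prodn_gt0 => i; apply: fact_gt0.
have A_gt0 : (0 < A)%N by apply: prodn_gt0 => i; rewrite expn_gt0; case: (a i).
have M_gt0 : (0 < M)%N by move: (fact_gt0 n); rewrite -MP muln_gt0 => /andP[].
(* [c_le] and [type_le] are chained and the positive factor [A] is cancelled. *)
have cP_le : `|c| ^+ 2 * P%:R <= (B * n`!)%N%:R.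
  have A0 : (0 : R[i]) < A%:R by rewrite ltr0n.
  rewrite -(ler_pM2r A0) mulrAC.
  apply: (@le_trans _ _ (Y * P)%N%:R); first by rewrite natrM ler_wpM2r ?ler0n.
  by rewrite -natrM ler_nat -mulnA.
set X : R := _ * _ * _.
have X_ge0 : 0 <= X by rewrite !mulr_ge0 ?invr_ge0 ?sqrtr_ge0 ?ler0n.
(* Writing [n! = M * P] turns [n! ^ 2 / M] into [n! * P], so that after squaring the goal reduces to
   [cP_le]. *)
have XE : X ^+ 2 = (B * n`!)%N%:R * P%:R / Y%:R ^+ 2.
  rewrite /X !exprMn !exprVn !sqr_sqrtr ?ler0n // -MP !natrM.
  have M0 : (M%:R : R) != 0 by rewrite pnatr_eq0 -lt0n.
  have Y0 : (Y%:R : R) != 0 by rewrite pnatr_eq0 -lt0n.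
  by field; rewrite Y0 M0.
have XCE : X%:C ^+ 2 = (B * n`!)%N%:R * P%:R / Y%:R ^+ 2.
  rewrite -(rmorphXn (real_complex R) 2 X) XE.
  by rewrite !rmorphM fmorphV rmorphXn /= !rmorph_nat.
rewrite -(@ler_pXn2r _ 2) ?nnegrE ?normr_ge0 ?ler0c // XCE.
rewrite normrM normfV normr_nat normrMn -[_ *+ P]mulr_natr !exprMn exprVn mulrC.
rewrite ler_pM2r ?invr_gt0 ?exprn_gt0 ?ltr0n //.
by rewrite [P%:R ^+ 2]expr2 mulrA ler_wpM2r ?ler0n.
Qed.
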